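(* Every interval graph $G$ has convex crossing number $$\mathrm{cr}^{\star}(G)\;\leq\; \tfrac12(\omega(G)-2)\sum_{v\in V(G)}\deg(v)(\deg(v)-1)\;\leq\; (\omega(G)-2)(\omega(G)-1)(\Delta(G)-1)\,|V(G)|.$$
   Context: All graphs are undirected, simple and finite. $\Delta(G)$ is the maximum degree and $\omega(G)$ the maximum size of a clique of $G$. An interval graph is the intersection graph of a set of intervals in $\mathbb{R}$. A convex drawing of a graph represents the vertices by distinct points in the plane in convex position and each edge by the line-segment between its endpoints, such that the only vertices an edge intersects are its own endpoints, and no three edges intersect at a common point (except at a common endpoint). A crossing is a point of intersection between two edges other than a common endpoint. The convex crossing number $\mathrm{cr}^{\star}(G)$ is the minimum number of crossings in a convex drawing of $G$. *)

(* Defs.v *)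
From HB Require Import structures.
From mathcomp Require Import all_boot all_order all_algebra.
From mathcomp Require Import mathcomp_extra boolp classical_sets set_interval.
From mathcomp Require Import cardinality reals convex.

Set Implicit Arguments.
Unset Strict Implicit.
Unset Printing Implicit Defensive.

Import Order.TTheory GRing.Theory Num.Theory.
Local Open Scope classical_set_scope.
Local Open Scope card_scope.
Local Open Scope ring_scope.

(* A finite simple graph is a symmetric irreflexive relation e on a finType. *)

Section Graphs.
Variables (T : finType) (e : rel T).

Definition edges : {set {set T}} :=
  [set [set uv.1; uv.2]%SET | uv : T * T & e uv.1 uv.2]%SET.

Definition degree (v : T) : nat := #|[set u | e v u]%SET|.

Definition max_degree : nat := (\max_v degree v)%N.

Definition clique (K : {set T}) : bool :=
  [forall u in K, forall v in K, (u != v) ==> e u v].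

Definition clique_number : nat := (\max_(K : {set T} | clique K) #|K|)%N.

(* The intervals may be open, closed, half-open or unbounded, and distinct
   vertices may be assigned the same interval. *)
Definition interval_graph (R : realType) : Prop :=
  exists I : T -> interval R, forall u v : T,
    e u v <-> u != v /\ [set` I u] `&` [set` I v] !=set0.

End Graphs.

Section ConvexDrawings.
Variables (R : realType) (T : finType) (e : rel T).
Notation plane := 'rV[R]_2.
Implicit Types (p : T -> plane) (f g h : {set T}) (x : plane).

Definition segment (a b : plane) : set plane :=
  [set (1 - t) *: a + t *: b | t in `[0, 1]].

Definition convex_hull (A : set plane) : set plane := smallest (@convex_set R _) A.

(* Every point is a vertex of the convex hull of all of them. *)
Definition convex_position p : Prop :=
  forall v : T, ~ convex_hull [set p u | u in [set~ v]] (p v).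

(* The segment representing the edge f; both orderings of the endpoints of f
   are covered by the quantifiers and give the same segment. *)
Definition edge_segment p f : set plane :=
  [set x | exists u v : T, f = [set u; v]%SET /\ segment (p u) (p v) x].

Record convex_drawing p : Prop := {
  drawing_inj : injective p;
  drawing_convex : convex_position p;
  drawing_avoids_vertices : forall f w,
    f \in edges e -> edge_segment p f (p w) -> w \in f;
  drawing_no_triple : forall f g h x,
    f \in edges e -> g \in edges e -> h \in edges e ->
    f != g -> f != h -> g != h ->
    edge_segment p f x -> edge_segment p g x -> edge_segment p h x ->
    exists w, [/\ w \in f, w \in g, w \in h & x = p w] }.

Definition crossings p : set plane :=
  [set x | exists f g, [/\ f \in edges e, g \in edges e & f != g] /\
    [/\ edge_segment p f x, edge_segment p g x &
        ~ exists w, [/\ w \in f, w \in g & x = p w]]].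

Definition drawable_with (k : nat) : Prop :=
  exists2 p, convex_drawing p & crossings p #= `I_k.

(* k is the minimum number of crossings in a convex drawing. *)
Definition is_convex_crossing_number (k : nat) : Prop :=
  drawable_with k /\ forall j, drawable_with j -> (k <= j)%N.

End ConvexDrawings.

(* Main.v *)
(* Order the vertices by the left endpoints of their intervals, so that
   [u < v < w] and [u ~ w] imply [u ~ v], and place them in this order on the
   parabola [Y = X^2]. A crossing then consists of edges [vw] and [xy] with
   [v < x < w < y], where [x] is adjacent to [v], [w] and [y]. Charge it to
   the path [w x y]: the vertices [v] charged to a given path form a clique
   together with [x] and [w], so there are at most [omega - 2] of them, and
   [x] is the middle of [deg x (deg x - 1) / 2] paths. The abscissae grow fast
   enough that no three disjoint chords are concurrent. For the second
   inequality, every vertex has at most [omega - 1] neighbours before it. *)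

Require Import Defs.
From mathcomp Require Import all_boot all_order all_algebra.
From mathcomp Require Import boolp classical_sets cardinality reals convex.
From mathcomp Require Import interval_inference.
From mathcomp Require Import ring lra zify.
From mathcomp Require Import fintype finset.

Set Implicit Arguments.
Unset Strict Implicit.
Unset Printing Implicit Defensive.

Import Order.TTheory GRing.Theory Num.Theory.

(** * Counting in an ordered graph *)

(** Double counting, used for every charging argument: [f] says where an object is charged and [n]
    bounds the load. *)
Lemma leq_card_fibers (A B : finType) (Q : {set A}) (P : {set B}) (f : A -> B)
    (n : B -> nat) :
  (forall q, q \in Q -> f q \in P) ->
  (forall p, p \in P -> #|[set q in Q | f q == p]| <= n p) ->
  #|Q| <= \sum_(p in P) n p.
Proof.
move=> QP le_n; rewrite -sum1_card (partition_big f (mem P)) //=.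
apply: leq_sum => p /le_n; rewrite -sum1_card; apply: leq_trans.
by rewrite leq_eqVlt; apply/orP; left; apply/eqP/eq_bigl => q; rewrite inE.
Qed.

Section Counting.
Variables (T : finType) (e : rel T) (r : T -> nat).
Hypotheses (e_sym : symmetric e) (e_irr : irreflexive e) (r_inj : injective r).

(** Swapping components matches increasing pairs with decreasing ones; a tie in [r] would force
    equal components, which [a] excludes. *)
Lemma card_sym_pairs (a : rel T) : symmetric a -> irreflexive a ->
  #|[set p | a p.1 p.2]| = (#|[set p | a p.1 p.2 & r p.1 < r p.2]|).*2.
Proof.
move=> a_sym a_irr; rewrite -addnn.
rewrite -(cardsID [set p | r p.1 < r p.2] [set p | a p.1 p.2]); congr (_ + _).
  by apply: eq_card => p; rewrite !inE.
have swapK : involutive (fun p : T * T => (p.2, p.1)) by case.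
rewrite -[RHS](card_imset _ (inv_inj swapK)); apply: eq_card => -[u v].
rewrite !inE /=; apply/idP/imsetP => [/andP[uv auv]|[[u' v'] + [-> ->]]].
  exists (v, u) => //; rewrite inE /= a_sym auv /=; rewrite -leqNgt in uv.
  rewrite ltn_neqAle uv andbT; apply: contraTneq auv => /r_inj ->.
  by rewrite a_irr.
by rewrite inE /= -leqNgt => /andP[auv /ltnW ->]; rewrite a_sym.
Qed.

Lemma card_neighbour_pairs x :
  #|[set p | [&& e x p.1, e x p.2 & p.1 != p.2]]| =
  degree e x * (degree e x).-1.
Proof.
set N := [set u | e x u].
have <- : setX N N :\: [set (u, u) | u in N] =
    [set p | [&& e x p.1, e x p.2 & p.1 != p.2]].
  apply/setP => -[u v]; rewrite !inE /=.
  have [<-|uv] := eqVneq u v.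
    rewrite !andbF; apply/andP => -[/negP nu /andP[xu _]].
    by apply: nu; apply/imsetP; exists u; rewrite ?inE.
  rewrite andbT; case: (e x u && e x v); rewrite ?andbF ?andbT //.
  by apply/imsetP => -[w _ [uw vw]]; rewrite uw vw eqxx in uv.
rewrite cardsD (setIidPr _); last first.
  by apply/subsetP => _ /imsetP[u uN ->]; rewrite inE uN.
rewrite cardsX card_imset; last by move=> u v [].
by rewrite /degree -/N -subn1 mulnBr muln1.
Qed.

Lemma sum_degree : \sum_v degree e v = #|[set p | e p.1 p.2]|.
Proof.
under eq_bigr do rewrite /degree -sum1_card.
rewrite pair_big_dep -sum1_card; apply: eq_bigl => p.
by rewrite !inE.
Qed.

Lemma leq_clique (K : {set T}) : clique e K -> #|K| <= clique_number e.
Proof. exact: leq_bigmax_cond. Qed.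

Lemma leq_degree v : degree e v <= max_degree e.
Proof. exact: leq_bigmax. Qed.

Lemma edge_clique_number u v : e u v -> 2 <= clique_number e.
Proof.
move=> euv; have <- : #|[set u; v]| = 2.
  by rewrite cards2; case: eqP euv => // ->; rewrite e_irr.
apply: leq_clique; apply/forall_inP => a aK; apply/forall_inP => b bK.
apply/implyP; move: aK bK; rewrite !inE.
by move=> /orP[]/eqP-> /orP[]/eqP->; rewrite ?eqxx // e_sym.
Qed.

Lemma clique_number_edge : 2 <= clique_number e -> exists u v, e u v.
Proof.
move=> cl2; have /existsP[u /existsP[v euv]] : [exists u, exists v, e u v].
  apply: contraLR cl2 => no_edge; rewrite -ltnNge ltnS.
  apply/bigmax_leqP => K /forall_inP clK; rewrite leqNgt.
  apply: contra no_edge => /card_gt1P[u [v [uK vK uv]]].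
  apply/existsP; exists u; apply/existsP; exists v.
  by move/forall_inP/(_ v vK)/implyP: (clK u uK); apply.
by exists u, v.
Qed.

Lemma clique_number_gt0 (v : T) : 0 < clique_number e.
Proof.
rewrite -(cards1 v); apply: leq_clique.
apply/forall_inP => a; rewrite inE => /eqP ->.
by apply/forall_inP => b; rewrite inE => /eqP ->; rewrite eqxx.
Qed.

Hypothesis e_left : forall u v w, r u < r v -> r v < r w -> e u w -> e u v.

(** Two earlier neighbours of [w] are adjacent by [e_left], so together with [w] they form a clique;
    [w] itself makes the inequality strict. *)
Lemma card_left_neighbours w :
  #|[set v | r v < r w & e v w]| < clique_number e.
Proof.
set L := [set v | r v < r w & e v w].
have wL : w \notin L by rewrite inE ltnn.
have -> : #|L|.+1 = #|w |: L| by rewrite cardsU1 wL.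
apply: leq_clique; apply/forall_inP => a aK; apply/forall_inP => b bK.
apply/implyP => ab; move: aK bK; rewrite !inE.
move=> /predU1P[aw|/andP[aw eaw]] /predU1P[bw|/andP[bw ebw]].
- by rewrite aw bw eqxx in ab.
- by rewrite aw e_sym.
- by rewrite bw.
have [lt_ab|lt_ba|/r_inj eq_ab] := ltngtP (r a) (r b).
- exact: e_left lt_ab bw eaw.
- by rewrite e_sym; apply: e_left lt_ba aw ebw.
- by rewrite eq_ab eqxx in ab.
Qed.

(** Each edge is charged to its later endpoint, which receives at most omega - 1 of them. *)
Lemma sum_degree_le :
  \sum_v degree e v <= (#|T| * (clique_number e).-1).*2.
Proof.
rewrite sum_degree card_sym_pairs // leq_double -cardsT -sum_nat_const.
apply: (leq_card_fibers (f := snd)) => [q _|w _]; first by rewrite inE.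
have := card_left_neighbours w; case: clique_number => // k; rewrite ltnS.
apply: leq_trans.
rewrite -(@card_in_imset _ _ (fun q : T * T => q.1)); last first.
  move=> [u v] [u' v']; rewrite !inE /=.
  by move=> /andP[_ /eqP ->] /andP[_ /eqP ->] ->.
apply/subset_leq_card/subsetP => _ /imsetP[[u v] + ->]; rewrite !inE /=.
by move=> /andP[/andP[euv uv] /eqP <-]; rewrite uv.
Qed.

(* The quadruple [(v, x, w, y)] encodes the crossing of [vw] and [xy]. *)
Definition crossing_quads : {set T * T * T * T} :=
  [set q | let: (v, x, w, y) := q in
    [&& r v < r x, r x < r w, r w < r y, e v w & e x y]].

Lemma card_crossing_quads :
  (#|crossing_quads|).*2 <=
  (clique_number e - 2) * \sum_x degree e x * (degree e x).-1.
Proof.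
pose P : {set T * (T * T)} :=
  [set p | [&& e p.1 p.2.1, e p.1 p.2.2 & r p.1 < r p.2.1 < r p.2.2]].
pose charge (q : T * T * T * T) := (q.1.1.2, (q.1.2, q.2)).
have leQP : #|crossing_quads| <= #|P| * (clique_number e - 2).
  rewrite -sum_nat_const.
  apply: (@leq_card_fibers _ _ _ _ charge) => [[[[v x] w] y]|[x [w y]]].
    rewrite !inE /= => /and5P[vx xw wy evw exy].
    by rewrite exy xw wy (e_left xw wy exy).
  rewrite inE /= => /and3P[exw _ /andP[xw wy]].
  rewrite -(@card_in_imset _ _ (fun q : T * T * T * T => q.1.1.1)); last first.
    move=> [[[v1 x1] w1] y1] [[[v2 x2] w2] y2]; rewrite !inE /charge /=.
    by move=> /andP[_ /eqP[-> -> ->]] /andP[_ /eqP[-> -> ->]] ->.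
  (* Both [x] and the charged vertices [v] precede [w] and are adjacent to it. Discarding [x] from
     fewer than omega such vertices leaves at most omega - 2. *)
  have := card_left_neighbours w; rewrite (cardsD1 x) inE xw exw /= => lt_cl.
  rewrite leq_subRL; last exact: leq_trans lt_cl.
  rewrite addnC addn2; apply: leq_trans lt_cl; rewrite !ltnS.
  apply/subset_leq_card/subsetP => _ /imsetP[[[[v x'] w'] y'] + ->].
  rewrite !inE /charge /= => /andP[/and5P[vx xw' _ evw _] /eqP[ex ew _]].
  rewrite -ew evw (ltn_trans vx xw') !andbT.
  by apply: contraTneq vx => ->; rewrite ex ltnn.
(* Forgetting that [x] precedes [w] leaves the unordered pairs of neighbours of [x]. *)
have leP : (#|P|).*2 <= \sum_x degree e x * (degree e x).-1.
  have : #|P| <= \sum_(x in [set: T])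
      #|[set p : T * T | [&& e x p.1, e x p.2 & p.1 != p.2] & r p.1 < r p.2]|.
    apply: (@leq_card_fibers _ _ _ _ fst) => [q _|x _]; first by rewrite inE.
    rewrite -(@card_in_imset _ _ (fun q : T * (T * T) => q.2)); last first.
      by move=> [x1 p1] [x2 p2]; rewrite !inE /=
        => /andP[_ /eqP ->] /andP[_ /eqP ->] ->.
    apply/subset_leq_card/subsetP => _ /imsetP[[x' [w y]] + ->].
    rewrite !inE /= => /andP[/and3P[xw xy /andP[_ wy]] /eqP <-].
    by rewrite xw xy wy !andbT; apply: contraTneq wy => ->; rewrite ltnn.
  rewrite -leq_double => /leq_trans; apply.
  rewrite -mul2n big_distrr /= leq_eqVlt; apply/orP; left; apply/eqP.
  apply: eq_big => [x|x _]; first by rewrite inE.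
  rewrite -card_neighbour_pairs mul2n.
  rewrite (@card_sym_pairs (fun u v => [&& e x u, e x v & u != v])) // =>
    [u v|u].
    by rewrite eq_sym andbCA.
  by rewrite eqxx !andbF.
rewrite mulnC; apply: leq_trans (leq_mul leP (leqnn _)).
by rewrite -doubleMl leq_double.
Qed.

End Counting.

Local Open Scope classical_set_scope.
Local Open Scope card_scope.
Local Open Scope ring_scope.

(** * Concurrent secants of a parabola *)

Section Concurrency.
Variable S : comPzRingType.

(* The determinant with rows [(1, a + b, a b)], [(1, c + d, c d)],
   [(1, e + f, e f)]: it vanishes when the secants [Y = (a + b) X - a b],
   etc., of the parabola [Y = X^2] meet in one point. *)
Definition secant_det (a b c d e f : S) : S :=
  (c + d) * (e * f) - (c * d) * (e + f) - (a + b) * (e * f)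
  + (a * b) * (e + f) + (a + b) * (c * d) - (a * b) * (c + d).

(** The determinant is the sum, over the secants, of the ordinate at [X] times a difference of the
    other two slopes. The ordinates all equal [Y], and the differences sum to zero. *)
Lemma secant_det_concurrent (a b c d e f X Y : S) :
  Y = (a + b) * X - a * b -> Y = (c + d) * X - c * d ->
  Y = (e + f) * X - e * f -> secant_det a b c d e f = 0.
Proof.
move=> hab hcd hef.
have -> : secant_det a b c d e f =
  ((a + b) * X - a * b) * ((c + d) - (e + f))
  + ((c + d) * X - c * d) * ((e + f) - (a + b))
  + ((e + f) * X - e * f) * ((a + b) - (c + d)).
  by rewrite /secant_det; ring.
by rewrite -hab -hcd -hef; ring.
Qed.

End Concurrency.

(* [secant_det] is affine in [f]. Slope and constant term do not both vanish,
   and an integral nonzero slope makes it nonzero for large [f]. *)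
Lemma secant_det_neq0_large (M a b c d e f : int) :
  0 < a <= M -> 0 < b <= M -> 0 < c <= M -> 0 < d <= M -> 0 < e <= M ->
  3 * M ^+ 3 < f -> c != a -> c != b -> e != a -> e != b ->
  secant_det a b c d e f != 0.
Proof.
move=> Ha Hb Hc Hd He Mf ca cb ea eb; apply/eqP => D0.
have cube x y z : 0 < x <= M -> 0 < y <= M -> 0 < z <= M ->
    0 <= x * y * z <= M ^+ 3.
  move=> /andP[x0 xM] /andP[y0 yM] /andP[z0 zM]; apply/andP; split.
    by rewrite !mulr_ge0 // ltW.
  by rewrite !exprS expr0 mulr1 mulrA !ler_pM ?mulr_ge0 // ltW.
pose g := (c + d) - (a + b).
pose s := a * b - c * d + g * e.
pose m := (a + b) * (c * d) - (a * b) * (c + d) + (a * b - c * d) * e.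
have Dsm : f * s + m = 0 by rewrite -D0 /secant_det /s /m /g; ring.
have [s0|s0] := eqVneq s 0.
  have m0 : m = 0 by move: Dsm; rewrite s0 mulr0 add0r.
  (* Eliminating between [s = 0] and [m = 0] gives [g = 0], as [e] is neither [a] nor [b]. Then the
     pairs [a, b] and [c, d] have equal sums and products, making [c] a root of [(X - a)(X - b)]. *)
  have : g * ((e - a) * (e - b)) = e * s - (a + b) * s - m.
    by rewrite /m /s /g; ring.
  rewrite s0 m0 !mulr0 !subr0 => /eqP.
  rewrite !mulf_eq0 !subr_eq0 (negPf ea) (negPf eb) !orbF => /eqP cdab.
  have : (c - a) * (c - b) = (g * c) + s - g * e by rewrite /s /g; ring.
  have g0 : g = 0 by rewrite /g cdab subrr.
  rewrite s0 g0 !mul0r oppr0 !addr0 => /eqP.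
  by rewrite mulf_eq0 !subr_eq0 (negPf ca) (negPf cb).
(* [m] consists of six products in [[0, M ^+ 3]], three with each sign. *)
have mM : `|m| <= 3 * M ^+ 3.
  have := cube a c d Ha Hc Hd; have := cube b c d Hb Hc Hd.
  have := cube a b c Ha Hb Hc; have := cube a b d Ha Hb Hd.
  have := cube a b e Ha Hb He; have := cube c d e Hc Hd He.
  have -> : m = a * c * d + b * c * d - a * b * c - a * b * d
                + a * b * e - c * d * e by rewrite /m; ring.
  by move: (a * c * d) (b * c * d) (a * b * c) (a * b * d) (a * b * e)
    (c * d * e) (M ^+ 3) => ? ? ? ? ? ? ?; lia.
have fM : `|f| <= `|m|.
  have -> : m = - (f * s) by apply/eqP; rewrite -addr_eq0 addrC Dsm.
  by rewrite normrN normrM ler_peMr // -gtz0_ge1 normr_gt0.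
by move: Mf mM fM; move: (M ^+ 3) => ?; lia.
Qed.

(** Each value is the fourth power of the preceding one and at least 4, hence exceeds the threshold
    [3 * M ^+ 3] of [secant_det_neq0_large] with [M] the preceding value. *)
Definition tower (i : nat) : nat := 4 ^ (4 ^ i).

Lemma tower_gt0 i : (0 < tower i)%N.
Proof. by rewrite expn_gt0. Qed.

Lemma tower_growth i j : (i < j)%N -> (3 * tower i ^ 3 < tower j)%N.
Proof.
move=> ij; apply: (@leq_trans (4 * tower i ^ 3)).
  by rewrite ltn_pmul2r // !expn_gt0.
apply: (@leq_trans (tower i.+1)).
  have -> : tower i.+1 = (tower i ^ 4)%N by rewrite /tower expnSr expnM.
  by rewrite [leqRHS]expnS leq_mul2r (@leq_exp2l 4 1) // expn_gt0 orbT.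
by rewrite leq_exp2l // leq_exp2l.
Qed.

Lemma tower_lt i j : (i < j)%N -> (tower i < tower j)%N.
Proof. by move=> ij; rewrite ltn_exp2l // ltn_exp2l. Qed.

Lemma tower_inj : injective tower.
Proof.
move=> i j; have [/tower_lt|/tower_lt|//] := ltngtP i j => + eq_ij.
  by rewrite eq_ij ltnn.
by rewrite eq_ij ltnn.
Qed.

(** The determinant is symmetric within each pair up to sign-free exchange and invariant under
    rotating the pairs. So each pair may be taken increasing with the largest index last, where the
    growth of [tower] applies. *)
Lemma secant_det_tower (R : numDomainType) (a b c d e f : nat) :
  uniq [:: a; b; c; d; e; f] ->
  secant_det (tower a)%:R (tower b)%:R (tower c)%:R (tower d)%:R
    (tower e)%:R (tower f)%:R != 0 :> R.
Proof.
move=> U; pose t i := (tower i)%:Z.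
(* The growth argument needs integrality, so it is carried out in [int]. *)
suff : secant_det (t a) (t b) (t c) (t d) (t e) (t f) != 0.
  rewrite -(intr_eq0 R) /secant_det.
  by rewrite !(rmorphB, rmorphD, rmorphM) /= -!pmulrn.
have swap x y z w u v :
    secant_det x y z w u v = secant_det x y z w v u :> int.
  by rewrite /secant_det; ring.
have rotD x y z w u v :
    secant_det x y z w u v = secant_det z w u v x y :> int.
  by rewrite /secant_det; ring.
have swap_uniq x y z w u v :
    uniq [:: x; y; z; w; u; v] -> uniq [:: x; y; z; w; v; u].
  by rewrite (@perm_uniq _ _ [:: x; y; z; w; v; u]) // !perm_cons
    (perm_catC [:: u] [:: v]).
have rot_uniq x y z w u v :
    uniq [:: x; y; z; w; u; v] -> uniq [:: z; w; u; v; x; y].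
  by rewrite -(rot_uniq 2).
have last_max x y z w u v : uniq [:: x; y; z; w; u; v] ->
    (x < y)%N -> (z < w)%N -> (u < v)%N -> (y < v)%N -> (w < v)%N ->
    secant_det (t x) (t y) (t z) (t w) (t u) (t v) != 0.
  move=> U' xy zw uv yv wv.
  have v0 : (0 < v)%N by apply: leq_ltn_trans uv.
  have le k : (k < v)%N -> 0 < t k <= t v.-1.
    move=> kv; rewrite /t ltz_nat tower_gt0 lez_nat leq_exp2l // leq_exp2l //.
    by rewrite -ltnS prednK.
  have neq i j : i != j -> t i != t j by apply: contra => /eqP[] /tower_inj ->.
  (* All other indices are below [v], so [t v.-1] bounds their values. *)
  apply: (@secant_det_neq0_large (t v.-1));
    rewrite ?le ?(ltn_trans xy) ?(ltn_trans zw) //;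
    try by apply: neq; apply: contraTneq U' => ->;
           rewrite /= !inE eqxx ?orbT ?andbF.
  have := @tower_growth v.-1 v; rewrite prednK // leqnn => /(_ isT).
  by rewrite /t; move: (tower _) (tower _) => ? ?; lia.
have sorted_pairs x y z w u v : uniq [:: x; y; z; w; u; v] ->
    (x < y)%N -> (z < w)%N -> (u < v)%N ->
    secant_det (t x) (t y) (t z) (t w) (t u) (t v) != 0.
  move=> U' xy zw uv.
  have : [|| (y < v) && (w < v), (v < w) && (y < w) | (w < y) && (v < y)]%N.
    have : [&& y != v, w != v & y != w].
      by apply/and3P; split; apply: contraTneq U' => ->;
        rewrite /= !inE eqxx ?orbT ?andbF.
    by lia.
  case/or3P => /andP[lt1 lt2]; first exact: last_max.
    by rewrite -rotD; apply: last_max => //; apply/rot_uniq/rot_uniq.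
  by rewrite rotD; apply: last_max => //; apply: rot_uniq.
have sort_last x y z w u v : uniq [:: x; y; z; w; u; v] ->
    (x < y)%N -> (z < w)%N ->
    secant_det (t x) (t y) (t z) (t w) (t u) (t v) != 0.
  move=> U' xy zw; have [lt|lt|eq_uv] := ltngtP u v; first exact: sorted_pairs.
    by rewrite swap; apply: sorted_pairs => //; apply: swap_uniq.
  by move: U'; rewrite eq_uv /= !inE eqxx ?andbF.
have sort_mid x y z w u v : uniq [:: x; y; z; w; u; v] -> (x < y)%N ->
    secant_det (t x) (t y) (t z) (t w) (t u) (t v) != 0.
  move=> U' xy; have [lt|lt|eq_zw] := ltngtP z w; first exact: sort_last.
    rewrite rotD rotD swap rotD; apply: sort_last => //.
    by apply/rot_uniq/swap_uniq/rot_uniq/rot_uniq.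
  by move: U'; rewrite eq_zw /= !inE eqxx ?andbF.
have [lt|lt|eq_ab] := ltngtP a b; first exact: sort_mid.
  by rewrite rotD swap -rotD; apply: sort_mid => //;
    apply/rot_uniq/rot_uniq/swap_uniq/rot_uniq.
by move: U; rewrite eq_ab /= !inE eqxx ?andbF.
Qed.

(** * Chords of a parabola *)

Section Parabola.
Variable R : realType.
Implicit Types (a b c d s : R) (x y : 'rV[R]_2).

Definition parabola s : 'rV[R]_2 := \row_j s ^+ j.+1.

(** The product condition puts the abscissa between [a] and [b] without deciding which is
    smaller. *)
Definition chord a b x : Prop :=
  x 0 1 = (a + b) * x 0 0 - a * b /\ (x 0 0 - a) * (x 0 0 - b) <= 0.

Lemma parabola0 s : parabola s 0 0 = s.
Proof. by rewrite mxE expr1. Qed.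

Lemma parabola1 s : parabola s 0 1 = s ^+ 2.
Proof. by rewrite mxE. Qed.

Lemma rV2P x y : x 0 0 = y 0 0 -> x 0 1 = y 0 1 -> x = y.
Proof.
move=> h0 h1; apply/rowP; case=> [[|[|//]] i2].
  by rewrite (_ : Ordinal i2 = 0) //; apply: val_inj.
by rewrite (_ : Ordinal i2 = 1) //; apply: val_inj.
Qed.

Lemma parabola_inj : injective parabola.
Proof. by move=> a b /(congr1 (fun x => x 0 0)); rewrite !parabola0. Qed.

Lemma chordC a b x : chord a b x -> chord b a x.
Proof. by case=> hY hX; split; [rewrite hY; ring | rewrite mulrC]. Qed.

Lemma segment_chord a b x :
  segment (parabola a) (parabola b) x -> chord a b x.
Proof.
case=> t /=; rewrite in_itv /= => /andP[t0 t1] <-.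
have eX i : ((1 - t) *: parabola a + t *: parabola b) 0 i
    = (1 - t) * parabola a 0 i + t * parabola b 0 i.
  by rewrite mxE [X in X + _]mxE [X in _ + X]mxE.
rewrite /chord !eX !parabola0 !parabola1; split; first by ring.
have -> : ((1 - t) * a + t * b - a) * ((1 - t) * a + t * b - b)
  = - (t * (1 - t) * (a - b) ^+ 2) by ring.
by rewrite oppr_le0 mulr_ge0 ?sqr_ge0 ?mulr_ge0 ?subr_ge0.
Qed.

(** On the parabola, the height above the secant is [(c - a) * (c - b)]. *)
Lemma chord_parabola a b c : chord a b (parabola c) -> c = a \/ c = b.
Proof.
case; rewrite parabola0 parabola1 => hY _.
have /eqP : (c - a) * (c - b) = 0.
  by rewrite -(subrr (c ^+ 2)) {2}hY; ring.
by rewrite mulf_eq0 !subr_eq0 => /orP[]/eqP; [left|right].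
Qed.

Lemma chord_common_endpoint a b c x : b != c ->
  chord a b x -> chord a c x -> x = parabola a.
Proof.
move=> bc [hb _] [hc _].
have : (b - c) * (x 0 0 - a) = 0.
  by rewrite -(subrr (x 0 1)) {1}hb hc; ring.
move/eqP; rewrite mulf_eq0 !subr_eq0 (negPf bc) /= => /eqP xa.
by apply: rV2P; rewrite ?parabola0 ?parabola1 ?xa // hb xa; ring.
Qed.

(** At the common point, [(X - a)(X - b)] and [(X - c)(X - d)] both equal [X ^+ 2 - Y]. Since [X]
    lies in both intervals, they are not disjoint; strict nesting would make the products differ. *)
Lemma chord_interleave a b c d x : a < b -> c < d -> a < c ->
  chord a b x -> chord c d x -> c != b -> d != b -> c < b < d.
Proof.
move=> ab cd ac [hY hX] [hY' hX'] cb db.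
have heq : (x 0 0 - a) * (x 0 0 - b) = (x 0 0 - c) * (x 0 0 - d).
  have -> : (x 0 0 - a) * (x 0 0 - b) = x 0 0 ^+ 2 - x 0 1 by rewrite hY; ring.
  by rewrite hY'; ring.
move: (x 0 0) hX hX' heq => X hX hX' heq.
have cX : c <= X by rewrite leNgt; apply/negP => ?; nra.
have Xd : X <= d by rewrite leNgt; apply/negP => ?; nra.
have Xb : X <= b by rewrite leNgt; apply/negP => ?; nra.
apply/andP; split; first by rewrite lt_neqAle cb (le_trans cX).
rewrite ltNge; apply/negP => db'.
have dltb : d < b by rewrite lt_neqAle db.
have : (X - c) * (d - X) < (X - a) * (b - X) by apply: ltr_pM; lra.
by nra.
Qed.

(** The slopes [a + b] and [c + d] differ, so the secants are not parallel. *)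
Lemma chord_unique a b c d x y : a < c -> b < d ->
  chord a b x -> chord c d x -> chord a b y -> chord c d y -> x = y.
Proof.
move=> ac bd [hx _] [hx' _] [hy _] [hy' _].
have /eqP : ((a + b) - (c + d)) * (x 0 0 - y 0 0) = 0.
  transitivity (((a + b) * x 0 0 - a * b) - ((c + d) * x 0 0 - c * d)
    - (((a + b) * y 0 0 - a * b) - ((c + d) * y 0 0 - c * d))); first by ring.
  by rewrite -hx -hx' -hy -hy' !subrr.
rewrite mulf_eq0 !subr_eq0 => /orP[/eqP|/eqP] h.
  by have := ltrD ac bd; rewrite h ltxx.
by apply: rV2P; rewrite // hx hy h.
Qed.

Lemma parabola_convex_position (T : finType) (t : T -> R) :
  injective t -> convex_position (parabola \o t).
Proof.
move=> t_inj v.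
(* [H] is the open half-plane above the tangent at [t v]: it contains every other point, at height
   [(t u - t v) ^+ 2] over the tangent, but not the point of tangency. *)
pose H := [set x : 'rV[R]_2 | 0 < x 0 1 - 2 * t v * x 0 0 + t v ^+ 2].
have Hc : convex_set (H : set (convex_lmodType 'rV[R]_2)).
  apply/convex_setW => x y; rewrite !in_setE /H /= => hx hy k k0 k1.
  have eX i : (conv k x y : 'rV[R]_2) 0 i
      = k%:num * x 0 i + (1 - k%:num) * y 0 i.
    by rewrite /conv /= mxE [X in X + _]mxE [X in _ + X]mxE.
  rewrite in_setE /= !eX.
  set K := k%:num in k0 k1 *.
  have -> : K * x 0 1 + (1 - K) * y 0 1
    - 2 * t v * (K * x 0 0 + (1 - K) * y 0 0) + t v ^+ 2 =
    K * (x 0 1 - 2 * t v * x 0 0 + t v ^+ 2)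
    + (1 - K) * (y 0 1 - 2 * t v * y 0 0 + t v ^+ 2) by ring.
  by rewrite addr_gt0 // mulr_gt0 // subr_gt0.
have sub : [set (parabola \o t) u | u in [set~ v]] `<=` H.
  move=> _ [u /= uv <-]; rewrite /H /= parabola0 parabola1.
  have -> : t u ^+ 2 - 2 * t v * t u + t v ^+ 2 = (t u - t v) ^+ 2 by ring.
  rewrite lt_neqAle sqr_ge0 andbT eq_sym sqrf_eq0 subr_eq0.
  by apply/eqP => /t_inj.
move=> /(smallest_sub Hc sub); rewrite /H /= parabola0 parabola1.
by rewrite (_ : _ + _ = 0) ?ltxx //; ring.
Qed.

End Parabola.

(** * The drawing *)

Lemma card_image_set (T : finType) (U : Type) (Q : {set T}) (f : T -> U)
    (A : set U) :
  A `<=` f @` [set` Q] -> exists2 k, (k <= #|Q|)%N & A #= `I_k.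
Proof.
move=> AQ.
have AI : A #<= `I_#|Q|.
  apply: (card_le_trans (B := [set` Q])).
    exact: card_le_trans (subset_card_le AQ) (card_image_le _ _).
  apply: (card_le_trans (B := [set: 'I_#|Q|])); last first.
    by have /card_eqPle[] := @card_II #|Q|.
  apply: card_le_trans (card_image_le enum_val _).
  apply: subset_card_le => x /= xQ.
  by exists (enum_rank_in xQ x) => //; rewrite enum_rankK_in.
have /finite_set_leP/finite_setP[k Ak] : exists n, A #<= `I_n by exists #|Q|.
exists k => //; rewrite -card_le_II; apply: card_le_trans AI.
by have /card_eqPle[] := Ak.
Qed.

Section Drawing.
Variables (R : realType) (T : finType) (e : rel T) (r : T -> nat).
Hypotheses (e_sym : symmetric e) (e_irr : irreflexive e) (r_inj : injective r).
Implicit Types (f g h : {set T}) (u v w : T) (x : 'rV[R]_2).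

Definition abscissa v : R := (tower (r v))%:R.

Definition drawing v : 'rV[R]_2 := parabola (abscissa v).

Lemma abscissa_lt u v : (r u < r v)%N -> abscissa u < abscissa v.
Proof. by move=> uv; rewrite ltr_nat tower_lt. Qed.

Lemma abscissa_inj : injective abscissa.
Proof. by move=> u v /eqP; rewrite eqr_nat => /eqP /tower_inj /r_inj. Qed.

Lemma edge_chord f x : f \in edges e -> edge_segment drawing f x ->
  exists u v, [/\ f = [set u; v]%SET, e u v &
                  chord (abscissa u) (abscissa v) x].
Proof.
case/imsetP=> -[u v] /=; rewrite inE /= => euv fuv.
case=> u' [v' [fuv' /segment_chord hx]].
exists u', v'; split=> //.
have : u' \in [set u; v]%SET by rewrite -fuv fuv' !inE eqxx.
have : v' \in [set u; v]%SET by rewrite -fuv fuv' !inE eqxx orbT.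
have uv : u != v by apply: contraTneq euv => ->; rewrite e_irr.
have uv' : u' != v'.
  have := cards2 u v; rewrite -fuv fuv' cards2 uv /=.
  by case: (u' != v').
rewrite !inE => /orP[]/eqP ev /orP[]/eqP eu; rewrite ?ev ?eu //.
- by rewrite ev eu eqxx in uv'.
- by rewrite e_sym.
- by rewrite ev eu eqxx in uv'.
Qed.

Lemma edge_chord_lt f x : f \in edges e -> edge_segment drawing f x ->
  exists u v, [/\ f = [set u; v]%SET, e u v, (r u < r v)%N &
                  chord (abscissa u) (abscissa v) x].
Proof.
move=> fE /(edge_chord fE)[u [v [fuv euv hx]]].
have [uv|vu|/r_inj uv] := ltngtP (r u) (r v).
- by exists u, v.
- by exists v, u; split; rewrite ?fuv 1?setUC 1?e_sym //; apply: chordC.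
- by rewrite uv e_irr in euv.
Qed.

Lemma edge_chord_endpoint f x w : f \in edges e -> edge_segment drawing f x ->
  w \in f -> exists2 u, f = [set w; u]%SET & chord (abscissa w) (abscissa u) x.
Proof.
move=> fE /(edge_chord fE)[u [v [fuv euv hx]]]; rewrite fuv !inE.
case/orP=> /eqP ->; first by exists v.
by exists u; [rewrite setUC | apply: chordC].
Qed.

Lemma edges_common_endpoint f g x w : f \in edges e -> g \in edges e ->
  f != g -> edge_segment drawing f x -> edge_segment drawing g x ->
  w \in f -> w \in g -> x = drawing w.
Proof.
move=> fE gE fg fx gx wf wg.
have [u fu hu] := edge_chord_endpoint fE fx wf.
have [v gv hv] := edge_chord_endpoint gE gx wg.
apply: chord_common_endpoint hu hv.
by apply: contra fg => /eqP/abscissa_inj uv; rewrite fu gv uv.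
Qed.

Lemma drawing_edge_vertex f w :
  f \in edges e -> edge_segment drawing f (drawing w) -> w \in f.
Proof.
move=> fE /(edge_chord fE)[u [v [-> _ /chord_parabola hw]]].
by rewrite !inE; case: hw => /abscissa_inj ->; rewrite eqxx ?orbT.
Qed.

Lemma drawing_convex_drawing : convex_drawing e drawing.
Proof.
split.
- by move=> u v /parabola_inj /abscissa_inj.
- exact/parabola_convex_position/abscissa_inj.
- exact: drawing_edge_vertex.
move=> f g h x fE gE hE fg fh gh fx gx hx.
(* If two of the edges share an endpoint, they meet only there, and the third edge passes through
   that vertex and so contains it. Otherwise all six endpoints are distinct and [secant_det_tower]
   forbids concurrency. *)
have share k l m : k \in edges e -> l \in edges e -> m \in edges e ->
    k != l -> edge_segment drawing k x -> edge_segment drawing l x ->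
    edge_segment drawing m x ->
    (k :&: l)%SET != set0 ->
    exists w, [/\ w \in k, w \in l, w \in m & x = drawing w].
  move=> kE lE mE kl kx lx mx /set0Pn[w]; rewrite inE => /andP[wk wl].
  have xw := edges_common_endpoint kE lE kl kx lx wk wl.
  exists w; split=> //; apply: drawing_edge_vertex => //.
  by rewrite -xw.
have [fg0|/(share _ _ _ fE gE hE fg fx gx hx)[w [? ? ? ?]]] :=
  eqVneq (f :&: g)%SET set0; last by exists w.
have [fh0|/(share _ _ _ fE hE gE fh fx hx gx)[w [? ? ? ?]]] :=
  eqVneq (f :&: h)%SET set0; last by exists w.
have [gh0|/(share _ _ _ gE hE fE gh gx hx fx)[w [? ? ? ?]]] :=
  eqVneq (g :&: h)%SET set0; last by exists w.
have [a [b [fab eab [hab _]]]] := edge_chord fE fx.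
have [c [d [gcd ecd [hcd _]]]] := edge_chord gE gx.
have [i [j [hij eij [hhij _]]]] := edge_chord hE hx.
have neq k l u v : (k :&: l)%SET = set0 -> u \in k -> v \in l -> u != v.
  move=> kl uk vl; apply: contraPneq kl => uv /setP/(_ v).
  by rewrite !inE vl -uv uk.
have neqe u v : e u v -> u != v.
  by move=> euv; apply: contraTneq euv => ->; rewrite e_irr.
have : uniq [:: a; b; c; d; i; j].
  have [af bf] : a \in f /\ b \in f by rewrite fab !inE !eqxx orbT.
  have [cg dg] : c \in g /\ d \in g by rewrite gcd !inE !eqxx orbT.
  have [ih jh] : i \in h /\ j \in h by rewrite hij !inE !eqxx orbT.
  rewrite /= !inE !negb_or (neqe _ _ eab) (neqe _ _ ecd) (neqe _ _ eij).
  by rewrite !(neq f g _ c) ?(neq f g _ d) ?(neq f h a) ?(neq f h b)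
    ?(neq g h c) ?(neq g h d).
rewrite -(map_inj_uniq r_inj) => /(secant_det_tower R).
by rewrite (secant_det_concurrent hab hcd hhij) eqxx.
Qed.

(** Edges sharing an endpoint meet only there, so crossing edges have four distinct endpoints and
    [chord_interleave] orders them. The edge with the earliest endpoint comes first. *)
Lemma crossings_quads x : crossings e drawing x ->
  exists2 q, q \in crossing_quads e r & let: (a, c, b, d) := q in
    chord (abscissa a) (abscissa b) x /\ chord (abscissa c) (abscissa d) x.
Proof.
case=> f [g [[fE gE fg] [fx gx nw]]].
have [a [b [fab eab ab hab]]] := edge_chord_lt fE fx.
have [c [d [gcd ecd cd hcd]]] := edge_chord_lt gE gx.
have neq u v : u \in f -> v \in g -> u != v.
  move=> uf vg; apply/eqP => uv; apply: nw; exists u; rewrite {2}uv; split=> //.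
  by apply: edges_common_endpoint fE gE fg fx gx _ _ => //; rewrite uv.
have [af bf] : a \in f /\ b \in f by rewrite fab !inE !eqxx orbT.
have [cg dg] : c \in g /\ d \in g by rewrite gcd !inE !eqxx orbT.
have tneq u v : u \in f -> v \in g -> abscissa u != abscissa v.
  by move=> uf vg; apply: contra (neq u v uf vg) => /eqP/abscissa_inj ->.
have lt_r u v : (abscissa u < abscissa v) = (r u < r v)%N.
  by rewrite ltr_nat ltn_exp2l // ltn_exp2l.
have [ac|ca|/r_inj acE] := ltngtP (r a) (r c).
- exists (a, c, b, d) => //; rewrite inE eab ecd ac.
  have := chord_interleave (abscissa_lt ab) (abscissa_lt cd) (abscissa_lt ac)
    hab hcd.
  by rewrite !lt_r => /(_ _ _)/andP[]; rewrite 1?eq_sym ?tneq // => -> ->.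
- exists (c, a, d, b) => //; rewrite inE eab ecd ca.
  have := chord_interleave (abscissa_lt cd) (abscissa_lt ab) (abscissa_lt ca)
    hcd hab.
  by rewrite !lt_r => /(_ _ _)/andP[]; rewrite ?tneq // => -> ->.
- by have := neq _ _ af cg; rewrite acE eqxx.
Qed.

Lemma card_crossings :
  exists2 k, (k <= #|crossing_quads e r|)%N & crossings e drawing #= `I_k.
Proof.
(* Interleaved chords meet at most once, so a quadruple determines its crossing; [0] is the value
   when the chords do not meet. *)
pose pt (q : T * T * T * T) : 'rV[R]_2 := let: (a, c, b, d) := q in
  xget 0 [set x | chord (abscissa a) (abscissa b) x /\
                  chord (abscissa c) (abscissa d) x].
apply: (@card_image_set _ _ _ pt) => x /crossings_quads[[[[a c] b] d] qQ qx].
exists (a, c, b, d) => //=.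
move: qQ; rewrite inE => /and5P[ac cb bd _ _].
apply: xget_unique => //= y [hy hy']; case: qx => hx hx'.
exact: chord_unique (abscissa_lt ac) (abscissa_lt bd) hy hy' hx hx'.
Qed.

End Drawing.

(** * Ordering an interval graph, and the two inequalities *)

Lemma interval_graph_order (R : realType) (T : finType) (e : rel T) :
  interval_graph e R -> exists2 r : T -> nat, injective r &
    forall u v w, (r u < r v)%N -> (r v < r w)%N -> e u w -> e u v.
Proof.
case=> I eI.
(* Empty intervals, whose vertices are isolated, come last. *)
pose left v : itv_bound R :=
  if `[<[set` I v] !=set0>] then let: Interval l _ := I v in l else +oo%O.
have leftE v x : x \in I v -> left v = let: Interval l _ := I v in l.
  by move=> xv; rewrite /left; case: asboolP => // -[]; exists x.
pose le u v := (left u <= left v)%O.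
have le_tr : transitive le by move=> ? ? ?; apply: le_trans.
have le_rf : reflexive le by move=> ?; apply: lexx.
have s_sorted : sorted le (sort le (enum T)).
  by apply: sort_sorted => u v; apply: le_total.
have s_all v : v \in sort le (enum T) by rewrite mem_sort mem_enum.
(* Positions in the sorted list break ties between equal left endpoints. *)
exists (fun v => index v (sort le (enum T))) => [u v|u v w uv vw].
  by apply: index_inj.
have uv' : le u v.
  by apply: (sorted_leq_index le_tr le_rf s_sorted); rewrite ?s_all // ltnW.
have vw' : le v w.
  by apply: (sorted_leq_index le_tr le_rf s_sorted); rewrite ?s_all // ltnW.
move=> /eI[_ [x /= [xu xw]]]; apply/eI; split.
  by apply: contraTneq uv => ->; rewrite ltnn.
move: uv' vw'; rewrite /le (leftE _ _ xu) (leftE _ _ xw) {1 2}/left.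
(* If [I v] were empty, [left v] would be [+oo], which cannot be at most the left end of the
   nonempty [I w]. *)
case: asboolP => [[y /= yv]|_] uv' vw'; last first.
  by move: xw vw'; rewrite /=; case: (I w) => -[b z|[]] ?.
move: xu xw yv uv' vw'; case Iu: (I u) => [lu ru]; case Iv: (I v) => [lv rv].
case: (I w) => [lw rw]; rewrite !itv_boundlr.
move=> /andP[lux xru] /andP[lwx _] /andP[lvy yrv] lulv lvlw.
(* The smaller of [x] and [y] lies in both [I u] and [I v]. *)
have [yx|xy] := leP y x.
  exists y; split; rewrite /= ?Iu ?Iv itv_boundlr ?lvy ?yrv //.
  by rewrite (le_trans lulv lvy) (le_trans _ xru) // bnd_simp.
exists x; split; rewrite /= ?Iu ?Iv itv_boundlr ?lux ?xru //.
by rewrite (le_trans lvlw lwx) (le_trans _ yrv) // bnd_simp ltW.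
Qed.

Lemma convex_crossing_number_exists (R : realType) (T : finType) (e : rel T)
    (n : nat) :
  drawable_with R e n ->
  exists2 k, is_convex_crossing_number R e k & (k <= n)%N.
Proof.
move=> dn; have ex : exists k, `[<drawable_with R e k>].
  by exists n; apply/asboolP.
case: (ex_minnP ex) => k /asboolP dk min_k.
by exists k; [split=> // j dj; apply/min_k/asboolP | apply/min_k/asboolP].
Qed.

Theorem theorem17 (R : realType) (T : finType) (e : rel T)
    (e_sym : symmetric e) (e_irr : irreflexive e)
    (e_int : interval_graph e R) :
  exists2 k : nat, is_convex_crossing_number R e k &
    k%:R <= (2^-1 : R) * ((clique_number e)%:R - 2) *
              \sum_(v : T) (degree e v)%:R * ((degree e v)%:R - 1)
         <= ((clique_number e)%:R - 2) * ((clique_number e)%:R - 1) *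
              ((max_degree e)%:R - 1) * #|T|%:R.
Proof.
have [r r_inj e_left] := interval_graph_order e_int.
have [n nQ cr_n] := card_crossings R e_sym e_irr r_inj.
have [|k cr_k kn] := @convex_crossing_number_exists R T e n.
  by exists (drawing R r); first exact: drawing_convex_drawing.
exists k => //; move/(leq_trans kn): nQ => {n kn cr_n}kQ.
have pred_natr m : (0 < m)%N -> m%:R - 1 = m.-1%:R :> R.
  by case: m => // m _; rewrite -natr1 addrK.
(* Truncated and real subtraction disagree at degree 0, but there the other factor vanishes. *)
have -> : \sum_v (degree e v)%:R * ((degree e v)%:R - 1) =
    (\sum_v degree e v * (degree e v).-1)%N%:R :> R.
  rewrite natr_sum; apply: eq_bigr => v _; rewrite natrM.
  by case: (posnP (degree e v)) => [->|/pred_natr ->]; rewrite ?mul0r.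
have quads := card_crossing_quads e_sym r_inj e_left.
have degs := sum_degree_le e_sym e_irr r_inj e_left.
have [w2|w2] := leqP 2 (clique_number e).
  have [u [v euv]] := clique_number_edge w2.
  have D1 : (0 < max_degree e)%N.
    apply: leq_trans (leq_degree e u).
    by apply/card_gt0P; exists v; rewrite inE.
  (* One factor is bounded by the maximum degree, the other is summed by [sum_degree_le]. *)
  have dd : (\sum_v degree e v * (degree e v).-1 <=
             (#|T| * (clique_number e).-1).*2 * (max_degree e).-1)%N.
    apply: (@leq_trans (\sum_v degree e v * (max_degree e).-1)%N).
      apply: leq_sum => x _.
      by rewrite leq_mul2l -!subn1 leq_sub2r ?leq_degree ?orbT.
    by rewrite -big_distrl /= leq_mul2r degs orbT.
  rewrite -(natrB _ w2) !pred_natr ?(ltnW w2) //.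
  move: (\sum_v _)%N dd quads => S dd quads.
  rewrite -mulrA (mulrC 2^-1); apply/andP; split.
    rewrite ler_pdivlMr // -!natrM ler_nat muln2.
    by apply: leq_trans quads; rewrite leq_double.
  rewrite ler_pdivrMr // -!natrM ler_nat -!mulnA leq_mul2l.
  by apply/orP; right; apply: leq_trans dd _; lia.
have no_edge u v : e u v = false.
  by apply: contraTF w2 => /(edge_clique_number e_sym e_irr); rewrite -leqNgt.
have deg0 v : degree e v = 0%N.
  apply/eqP; rewrite cards_eq0; apply/eqP/setP => u.
  by rewrite !inE no_edge.
have S0 : (\sum_v degree e v * (degree e v).-1 = 0)%N.
  by apply: big1 => v _; rewrite deg0.
move: quads; rewrite S0 muln0 leqn0 double_eq0 => /eqP q0.
move: kQ; rewrite q0 leqn0 => /eqP ->; rewrite mulr0 lexx /=.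
(* Without edges some factors on the right are negative, but the product is 0: either [#|T|] is 0,
   or omega is 1. *)
have [->|/card_gt0P[v _]] := posnP #|T|; first by rewrite mulr0.
have w1 : clique_number e = 1%N.
  by apply/eqP; rewrite eqn_leq clique_number_gt0 // andbT -ltnS.
by rewrite w1 subrr mulr0 !mul0r.
Qed.
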